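(* Let $\gamma=\deg G$ and assume $\gamma\geq 2g-2$. If \[ \lambda_s> s\,\frac{2\ell-s+1}{2(\ell+1)}\,n-\frac{\ell}{2}\,\gamma+\frac{\ell}{\ell+1}+g, \] then the homogeneous linear system $\boldsymbol{U}\boldsymbol{u}=\boldsymbol{0}$ has at least two linearly independent solutions $\boldsymbol{u}\in\mathbb{F}^\nu$ (and hence decoding with parameter $\lambda_s$, which requires a solution that is unique up to scalar multiples, fails).
   Context: Let $F$ be an algebraic function field of genus $g$ over a base field $\mathbb{F}$, and let $P_1,\dots,P_n,P_\infty$ be pairwise distinct rational places of $F$. Let $D=P_1+\cdots+P_n$ and let $G$ be a divisor of degree $\gamma$ with $\operatorname{supp}G\cap\operatorname{supp}D=\emptyset$. For a divisor $A$, $\mathcal{L}(A)=\{h\in F\setminus\{0\} : (h)\geq -A\}\cup\{0\}$ and $\mathfrak{l}(A)=\dim_{\mathbb{F}}\mathcal{L}(A)$. Fix integers $1\le s\leq\ell$ and $\lambda_s\geq0$, a received word $\boldsymbol{r}=(r_1,\dots,r_n)\in\mathbb{F}^n$ and an $\boldsymbol{r}$-interpolator $R$ of degree $\rho\geq0$, i.e. $R\in\mathcal{L}(G+\rho P_\infty)$, $R\notin\mathcal{L}(G+(\rho-1)P_\infty)$ and $R(P_i)=r_i$ for all $i$. Put $V_t=\lambda_sP_\infty+tG$ and $Q_t=\lambda_sP_\infty+t(G+\rho P_\infty)$ for $t=1,\dots,\ell$, and $W_j=\lambda_sP_\infty+j(G+\rho P_\infty-D)$ for $j=0,\dots,s-1$.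 Notation: for each divisor $A$, $\boldsymbol{\beta}_A\in\mathcal{L}(A)^{\mathfrak{l}(A)}$ is a row vector whose entries form a fixed $\mathbb{F}$-basis of $\mathcal{L}(A)$, chosen so that $\mathcal{L}(A)=\mathcal{L}(B)$ if and only if $\boldsymbol{\beta}_A=\boldsymbol{\beta}_B$. For $h\in\mathcal{L}(A)$, $h_A\in\mathbb{F}^{\mathfrak{l}(A)}$ is the unique (column) vector with $\boldsymbol{\beta}_A\cdot h_A=h$. For $p\in\mathcal{L}(B-A)$, $p_{B,A}\in\mathbb{F}^{\mathfrak{l}(B)\times\mathfrak{l}(A)}$ is the matrix whose $i$-th column is $(pa_i)_B$, where $(a_1,\dots,a_{\mathfrak{l}(A)})=\boldsymbol{\beta}_A$. A left kernel matrix of a matrix $M$ is a matrix whose rows form a basis of $\{x : xM=0\}$. Put $\nu=\sum_{r=1}^{\ell}\mathfrak{l}(V_r)+\sum_{j=0}^{s-1}\mathfrak{l}(W_j)$. For $t=1,\dots,\ell$, $\boldsymbol{U}_t\in\mathbb{F}^{\mathfrak{l}(Q_t)\times\nu}$ is the block matrix $[\boldsymbol{V}_{t,1}|\cdots|\boldsymbol{V}_{t,\ell}|\boldsymbol{W}_{t,0}|\cdots|\boldsymbol{W}_{t,s-1}]$, where $\boldsymbol{V}_{t,r}=1_{Q_t,V_r}$ if $t=r$ and $\boldsymbol{V}_{t,r}=0_{Q_t,V_r}$ if $t\ne r$, and $\boldsymbol{W}_{t,j}=-\binom{t}{j}(R^{t-j})_{Q_t,W_j}$ if $j\leq t$ and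 $\boldsymbol{W}_{t,j}=0_{Q_t,W_j}$ if $j>t$. The matrix $\boldsymbol{U}$ (with $\nu$ columns) is obtained by stacking $\boldsymbol{K}_1\boldsymbol{U}_1,\dots,\boldsymbol{K}_\ell\boldsymbol{U}_\ell$ vertically, where $\boldsymbol{K}_t=1_{Q_t,Q_t}$ if $1\leq t\leq s-1$ and $\boldsymbol{K}_t$ is a left kernel matrix of $1_{Q_t,Q_t-sD}$ if $s\leq t\leq\ell$. Decoding with parameter $\lambda_s$ is said to fail if the right kernel of $\boldsymbol{U}$ does not have $\mathbb{F}$-dimension exactly $1$. *)

(* Defs.v *)
From HB Require Import structures.
From mathcomp Require Import all_boot all_order all_algebra.
From mathcomp Require Import boolp classical_sets.
From mathcomp Require Export freeg.

Set Implicit Arguments.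
Unset Strict Implicit.
Unset Printing Implicit Defensive.

Import Order.TTheory GRing.Theory Num.Theory.
Local Open Scope classical_set_scope.
Local Open Scope ring_scope.

Section FunctionField.
Variables (K F : fieldType) (iota : {rmorphism K -> F}).

(* iota c_0 * b_0 + ... + iota c_(n-1) * b_(n-1), for a row vector b of
   elements of F and a column vector c of scalars. *)
Definition lincomb n (b : n.-tuple F) (c : 'cV[K]_n) : F :=
  \sum_(i < n) iota (c i 0) * tnth b i.

Definition is_basis n (S : set F) (b : n.-tuple F) : Prop :=
  (forall i, S (tnth b i)) /\
  (forall h, S h -> exists! c : 'cV[K]_n, lincomb b c = h).

Definition in_ratfun (x f : F) : Prop :=
  exists p q : {poly K},
    (map_poly iota q).[x] != 0 /\
    f = (map_poly iota p).[x] / (map_poly iota q).[x].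

(* F is a finite extension of K(x) for some x transcendental over K. *)
Definition function_field : Prop :=
  exists x : F, ~ algebraicOver iota x /\
    exists (m : nat) (b : m.-tuple F), forall f : F,
      exists c : 'I_m -> F,
        (forall i, in_ratfun x (c i)) /\ f = \sum_(i < m) c i * tnth b i.

(* Places are represented by their normalised discrete valuations, trivial on
   K.  The value at 0 should be +oo; fixing the junk value 0 instead makes
   equality of places the same as equality of valuations on F \ {0}. *)
Record place := Place {
  val_at :> F -> int;
  _ : val_at 0 = 0;
  _ : forall a : K, a != 0 -> val_at (iota a) = 0;
  _ : forall f h, f != 0 -> h != 0 -> val_at (f * h) = val_at f + val_at h;
  _ : forall f h, f != 0 -> h != 0 -> f + h != 0 ->
        Num.min (val_at f) (val_at h) <= val_at (f + h);
  _ : exists2 f, f != 0 & val_at f = 1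
}.

HB.instance Definition _ := gen_eqMixin place.
HB.instance Definition _ := gen_choiceMixin place.

Definition val_ring (P : place) : set F := [set f | f = 0 \/ 0 <= P f].
Definition max_ideal (P : place) : set F := [set f | f = 0 \/ 0 < P f].

(* The classes of the entries of b form a K-basis of the residue field
   val_ring P / max_ideal P. *)
Definition is_residue_basis (P : place) d (b : d.-tuple F) : Prop :=
  (forall i, val_ring P (tnth b i)) /\
  (forall f, val_ring P f ->
     exists! c : 'cV[K]_d, max_ideal P (f - lincomb b c)).

Definition place_deg (P : place) : nat :=
  xget 0%N [set d | exists b : d.-tuple F, is_residue_basis P b].

Definition rational (P : place) : Prop := place_deg P = 1%N.

(* f(P) = a, the residue field of P being identified with K. *)
Definition has_value (P : place) (f : F) (a : K) : Prop :=
  val_ring P f /\ max_ideal P (f - iota a).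

Definition divisor := {freeg place / int}.

(* Not freeg's deg, which ignores the degrees of the places. *)
Definition div_deg (A : divisor) : int :=
  \sum_(P <- dom A) coeff P A * (place_deg P)%:Z.

Definition RR (A : divisor) : set F :=
  [set h | h = 0 \/ (h != 0 /\ forall P : place, - coeff P A <= P h)].

(* The default value 0 of xget is only taken on infinite-dimensional spaces. *)
Definition ell (A : divisor) : nat :=
  xget 0%N [set d | exists b : d.-tuple F, is_basis (RR A) b].

(* g is the maximum of deg A - l(A) + 1 over all divisors A. *)
Definition has_genus (g : nat) : Prop :=
  (forall A : divisor, div_deg A - (ell A)%:Z + 1 <= g%:Z) /\
  (exists A : divisor, div_deg A - (ell A)%:Z + 1 = g%:Z).

(* R is an r-interpolator of degree rho with respect to P_1, ..., P_n, G. *)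
Definition interpolator n (P : 'I_n -> place) (Pinf : place) (G : divisor)
    (r : 'rV[K]_n) (rho : nat) (R : F) : Prop :=
  [/\ RR (G + << rho%:Z *g Pinf >>) R,
      ~ RR (G + << rho%:Z - 1 *g Pinf >>) R
    & forall i, has_value (P i) R (r 0 i)].

Definition basis_choice := forall A : divisor, (ell A).-tuple F.

Definition is_basis_choice (beta : basis_choice) : Prop :=
  (forall A, is_basis (RR A) (beta A)) /\
  (forall A B, RR A = RR B <-> tval (beta A) = tval (beta B)).

Section Coordinates.
Variable beta : basis_choice.

(* h_A, meaningful for h in L(A). *)
Definition coordv (A : divisor) (h : F) : 'cV[K]_(ell A) :=
  xget 0 [set c | lincomb (beta A) c = h].

(* p_{B,A}, meaningful for p in L(B - A). *)
Definition mulmat (p : F) (B A : divisor) : 'M[K]_(ell B, ell A) :=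
  \matrix_(i, j) coordv B (p * tnth (beta A) j) i 0.

End Coordinates.
End FunctionField.

Definition left_kernel_mx (K : fieldType) m n k
    (M : 'M[K]_(m, n)) (N : 'M[K]_(k, m)) : Prop :=
  row_free N /\ (forall x : 'rV[K]_m, x *m M = 0 <-> (x <= N)%MS).

Section Decoder.
Variables (K F : fieldType) (iota : {rmorphism K -> F}).
Variables (n s l lam rho : nat).
Variables (P : 'I_n -> place iota) (Pinf : place iota) (G : divisor iota).
Variables (R : F) (beta : basis_choice iota).

Definition Ddiv : divisor iota := \sum_(i < n) << P i >>.
Definition Vdiv (t : nat) : divisor iota := << lam%:Z *g Pinf >> + G *+ t.
Definition Qdiv (t : nat) : divisor iota :=
  << lam%:Z *g Pinf >> + (G + << rho%:Z *g Pinf >>) *+ t.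
Definition Wdiv (j : nat) : divisor iota :=
  << lam%:Z *g Pinf >> + (G + << rho%:Z *g Pinf >> - Ddiv) *+ j.

Definition nu : nat := (\sum_(r < l) ell (Vdiv r.+1) + \sum_(j < s) ell (Wdiv j))%N.

Definition Vblock (t r : nat) : 'M[K]_(ell (Qdiv t), ell (Vdiv r)) :=
  mulmat beta (if t == r then 1 else 0) (Qdiv t) (Vdiv r).

Definition Wblock (t j : nat) : 'M[K]_(ell (Qdiv t), ell (Wdiv j)) :=
  if (j <= t)%N
  then - ('C(t, j)%:R *: mulmat beta (R ^+ (t - j)) (Qdiv t) (Wdiv j))
  else mulmat beta 0 (Qdiv t) (Wdiv j).

Definition Ublock (t : nat) : 'M[K]_(ell (Qdiv t), nu) :=
  row_mx (\mxrow_(r < l) Vblock t r.+1) (\mxrow_(j < s) Wblock t j).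

(* The index t : 'I_l stands for t + 1 = 1, ..., l.  The matrices N t with
   t + 1 < s are not used. *)
Section Kernels.
Variables (k : 'I_l -> nat) (N : forall t : 'I_l, 'M[K]_(k t, ell (Qdiv t.+1))).

Definition left_kernels : Prop :=
  forall t : 'I_l, (s <= t.+1)%N ->
    left_kernel_mx
      (mulmat beta 1 (Qdiv t.+1) (Qdiv t.+1 - Ddiv *+ s)) (N t).

Definition Kheight (t : 'I_l) : nat :=
  if (t.+1 < s)%N then ell (Qdiv t.+1) else k t.

Definition Kmat (t : 'I_l) : 'M[K]_(Kheight t, ell (Qdiv t.+1)) :=
  if (t.+1 < s)%N as b
    return 'M[K]_(if b then ell (Qdiv t.+1) else k t, ell (Qdiv t.+1))
  then mulmat beta 1 (Qdiv t.+1) (Qdiv t.+1) else N t.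

Definition Umat : 'M[K]_(\sum_(t < l) Kheight t, nu) :=
  \mxcol_(t < l) (Kmat t *m Ublock t.+1).

End Kernels.
End Decoder.

Definition right_kernel (K : fieldType) m n (M : 'M[K]_(m, n)) :
    {vspace 'cV[K]_n} :=
  lker (linfun (mulmx M : 'cV[K]_n -> 'cV[K]_m)).

Definition decoding_fails (K : fieldType) m n (M : 'M[K]_(m, n)) : Prop :=
  \dim (right_kernel M) <> 1%N.

(* Main.v *)
(** A solution of the system is a tuple f_0, ..., f_l with f_t in L(V_t) such
    that e_t := f_t - sum_(j < min(t, s)) binom(t, j) R^(t - j) e_j, which always
    lies in L(Q_t), vanishes to order min(t, s) along D: then e_j is in L(W_j)
    for j < s, and e_t is in L(Q_t - sD), hence killed by K_t, for t >= s.  Each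
    of these is n min(t, s) linear conditions, since lowering a divisor by a
    rational place costs at most one dimension.  Riemann's inequality for the
    V_t, sum_t l(V_t) >= sum_t (lambda_s + t gamma + 1 - g), then leaves at least
    two dimensions. *)
Require Import Defs.
From HB Require Import structures.
From mathcomp Require Import all_boot all_order all_algebra.
From mathcomp Require Import boolp classical_sets.
From mathcomp Require Import zify lra ring.
Import Order.TTheory GRing.Theory Num.Theory.
Local Open Scope ring_scope.

Set Implicit Arguments.
Unset Strict Implicit.
Unset Printing Implicit Defensive.

(** * Maps into [F] that are linear over [K] *)

Section SemilinearMaps.
Variables (K F : fieldType) (iota : {rmorphism K -> F}) (V : lmodType K).

(** [F] carries no [K]-module structure here, only the embedding [iota], so linearity of a map into
    [F] is expressed through [iota]. *)
Definition klinear (f : V -> F) : Prop :=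
  forall a x y, f (a *: x + y) = iota a * f x + f y.

Lemma klinear0 f : klinear f -> f 0 = 0.
Proof.
by move=> fL; rewrite -{1}(addNr 0) -scaleN1r fL rmorphN1 mulN1r addNr.
Qed.

Lemma klinearZ f a x : klinear f -> f (a *: x) = iota a * f x.
Proof. by move=> fL; rewrite -[_ *: _]addr0 fL (klinear0 fL) addr0. Qed.

Lemma klinear_sum (I : Type) (r : seq I) (E : I -> V) f :
  klinear f -> f (\sum_(i <- r) E i) = \sum_(i <- r) f (E i).
Proof.
move=> fL; elim: r => [|i r IHr]; first by rewrite !big_nil (klinear0 fL).
by rewrite !big_cons -IHr -{1}[E i]scale1r fL rmorph1 mul1r.
Qed.

Lemma klinear_lincomb n (b : n.-tuple F) (h : V -> 'cV[K]_n) :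
  linear h -> klinear (fun x => lincomb iota b (h x)).
Proof.
move=> hL a x y; rewrite /lincomb hL mulr_sumr -big_split; apply: eq_bigr => i _.
by rewrite !mxE rmorphD rmorphM mulrDl mulrA.
Qed.

Lemma klinearB f h : klinear f -> klinear h ->
  klinear (fun x => f x - h x).
Proof. by move=> fL hL a x y; rewrite fL hL; ring. Qed.

End SemilinearMaps.

(** * Valuations and Riemann-Roch spaces *)

Section Valuations.
Variables (K F : fieldType) (iota : {rmorphism K -> F}).
Implicit Types (P : place iota) (A B : divisor iota).

(** The disjunct for 0 restores the value +oo that the junk value of [P] at 0 hides. *)
Definition val_ge P (k : int) (f : F) : Prop := f = 0 \/ k <= P f.

(** With the zero case moved under the quantifier, [RR A] is an intersection of local conditions,
    and closure properties can be checked place by place. *)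
Lemma RRE A f : RR A f <-> forall P, val_ge P (- coeff P A) f.
Proof.
split=> [[->|[f0 Af]] P|Af]; [by left|by right|].
have [->|/eqP f0] := pselect (f = 0); [by left|right; split=> // P].
by case: (Af P) => // /eqP; rewrite (negPf f0).
Qed.

Lemma val_ge0 P k : val_ge P k 0. Proof. by left. Qed.

Lemma val_geW P j k f : j <= k -> val_ge P k f -> val_ge P j f.
Proof. by move=> jk [->|kf]; [left|right; apply: le_trans kf]. Qed.

Lemma val_geM P j k f h : val_ge P j f -> val_ge P k h -> val_ge P (j + k) (f * h).
Proof.
have [->|f0] := eqVneq f 0; first by move=> _ _; left; rewrite mul0r.
have [->|h0] := eqVneq h 0; first by move=> _ _; left; rewrite mulr0.
case=> [/eqP|jf]; first by rewrite (negPf f0).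
case=> [/eqP|kh]; first by rewrite (negPf h0).
by right; case: P jf kh => v v0 va vM vD vt /= jf kh; rewrite vM // lerD.
Qed.

Lemma val_geD P k f h : val_ge P k f -> val_ge P k h -> val_ge P k (f + h).
Proof.
have [->|f0] := eqVneq f 0; first by rewrite add0r.
have [->|h0] := eqVneq h 0; first by rewrite addr0.
case=> [/eqP|kf]; first by rewrite (negPf f0).
case=> [/eqP|kh]; first by rewrite (negPf h0).
have [->|fh0] := eqVneq (f + h) 0; [by left|right].
case: P kf kh => v v0 va vM vD vt /= kf kh.
by apply: le_trans (vD _ _ f0 h0 fh0); rewrite le_min kf.
Qed.

Lemma val_ge_scalar P a : val_ge P 0 (iota a).
Proof.
have [->|a0] := eqVneq a 0; first by left; rewrite rmorph0.
by right; case: P => v v0 va vM vD vt /=; rewrite va.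
Qed.

Lemma val_ge_sum P k (I : Type) (r : seq I) (E : I -> F) :
  (forall i, val_ge P k (E i)) -> val_ge P k (\sum_(i <- r) E i).
Proof. by move=> PE; apply: big_ind => //; [apply: val_ge0|apply: val_geD]. Qed.

Lemma RR0 A : RR A 0. Proof. by left. Qed.

Lemma RRD A f h : RR A f -> RR A h -> RR A (f + h).
Proof. by rewrite !RRE => Af Ah P; apply: val_geD. Qed.

Lemma RRM A B f h : RR A f -> RR B h -> RR (A + B) (f * h).
Proof. by rewrite !RRE => Af Bh P; rewrite coeffD opprD; apply: val_geM. Qed.

Lemma RR_scale A a f : RR A f -> RR A (iota a * f).
Proof.
rewrite !RRE => Af P; rewrite -[- _]add0r.
by apply: val_geM => //; apply: val_ge_scalar.
Qed.

Lemma RRB A f h : RR A f -> RR A h -> RR A (f - h).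
Proof.
move=> Af Ah; apply: RRD => //; rewrite -mulN1r -(rmorphN1 iota).
exact: RR_scale.
Qed.

Lemma RR_natmul A m f : RR A f -> RR A (m%:R * f).
Proof. by rewrite -(rmorph_nat iota); apply: RR_scale. Qed.

Lemma RR_sum A (I : Type) (r : seq I) (p : pred I) (E : I -> F) :
  (forall i, p i -> RR A (E i)) -> RR A (\sum_(i <- r | p i) E i).
Proof. by move=> AE; apply: big_ind => //; [apply: RR0|apply: RRD]. Qed.

Lemma RRX A m f : RR A f -> RR (A *+ m) (f ^+ m).
Proof.
move=> Af; elim: m => [|m IHm]; last by rewrite exprS mulrS; apply: RRM.
rewrite RRE => P; rewrite coeff0 oppr0 expr0 -(rmorph1 iota).
exact: val_ge_scalar.
Qed.

Lemma RR_lincomb A n (b : n.-tuple F) c :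
  (forall i, RR A (tnth b i)) -> RR A (lincomb iota b c).
Proof. by move=> Ab; apply: RR_sum => i _; apply: RR_scale. Qed.

Lemma RR_sub A B f : (forall P, 0 <= coeff P B) -> RR (A - B) f -> RR A f.
Proof.
rewrite !RRE => B0 ABf P; apply: val_geW (ABf P).
by rewrite coeffB lerN2 gerBl.
Qed.

(** A uniformizer has value 1; its powers and their inverses take every integer value. *)
Lemma exists_val P (k : int) : exists2 z, z != 0 & P z = k.
Proof.
case: P => v v0 va vM vD [t t0 vt] /=.
have v1 : v 1 = 0 by rewrite -(rmorph1 iota) va ?oner_eq0.
have vX m : v (t ^+ m) = m.
  by elim: m => // m IHm; rewrite exprS vM ?expf_neq0 // vt IHm; lia.
case: k => m; first by exists (t ^+ m); rewrite ?expf_neq0.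
exists (t ^+ m.+1)^-1; first by rewrite invr_eq0 expf_neq0.
have tm0 : t ^+ m.+1 != 0 by rewrite expf_neq0.
have := vM _ _ tm0 (invr_neq0 tm0); rewrite mulfV // v1 vX; lia.
Qed.

(** Degree 1 excludes the default 0 of [xget], so a one-element residue basis exists. Its element
    [b] is kept as it is, not normalised to 1. *)
Lemma rational_residue P : rational P -> exists b, val_ge P 0 b /\
  forall f, val_ge P 0 f -> exists a, val_ge P 1 (f - iota a * b).
Proof.
rewrite /rational /place_deg; case: xgetP => [d _ [b [b_ge0 bP]] d1|_ //].
subst d; exists (tnth b ord0); split; first by case: (b_ge0 ord0); [left|right].
move=> f f_ge0; have [|c []] := bP f; first by case: f_ge0; [left|right].
by rewrite /lincomb big_ord1 => bc _; exists (c 0 0); case: bc; [left|right].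
Qed.

(** * The cost in dimension of lowering a divisor by rational places *)

Section DimensionDrop.
Variables (V : vectType K) (f : V -> F).
Hypothesis f_lin : klinear iota f.

(* Dividing by an element of order -v_P(A) turns the leading coefficient at P
   into a residue, so a single functional cuts out L(A - P). *)
Lemma dim_drop_place P A (W : {vspace V}) : rational P ->
  (forall x, x \in W -> RR A (f x)) ->
  exists W' : {vspace V}, [/\ (W' <= W)%VS, (\dim W <= (\dim W').+1)%N
    & forall x, x \in W' -> RR (A - << P >>) (f x)].
Proof.
move=> /rational_residue[b [b_ge0 bP]] WA; set w := vbasis W.
have [z z0 Pz] := exists_val P (- coeff P A).
have zV : val_ge P (coeff P A) z^-1.
  right; case: P Pz {bP b_ge0} => v v0 va vM vD vt /= vz.
  have := vM _ _ z0 (invr_neq0 z0).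
  rewrite mulfV // -(rmorph1 iota) va ?oner_eq0 // vz => /eqP.
  by rewrite eq_sym addrC subr_eq0 => /eqP->.
have fw_ge0 i : val_ge P 0 (f (tnth w i) / z).
  rewrite -(addNr (coeff P A)); apply: val_geM => //.
  by move: P {bP b_ge0 Pz zV}; apply/RRE/WA/vbasis_mem/mem_tnth.
have /choice[c cP] i : exists a, val_ge P 1 (f (tnth w i) / z - iota a * b).
  exact: bP.
(* The residues [c i] are chosen on the basis [w] only; extending them through coordinates makes
   [phi] linear by construction. *)
pose phi (x : V) : K^o := \sum_(i < \dim W) c i * coord w i x.
have phi_lin : linear phi.
  move=> a x y; rewrite /phi /= scaler_sumr -big_split; apply: eq_bigr => i _.
  by rewrite linearP mulrDr /= mulrCA.
pose phiL := GRing.isLinear.Build K V K^o *:%R phi phi_lin.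
pose phi' : {linear V -> K^o} := HB.pack phi phiL.
exists (W :&: lker (linfun phi'))%VS; split; first exact: capvSl.
  have := limg_ker_dim (linfun phi') W.
  have : (\dim (linfun phi' @: W) <= 1)%N.
    by rewrite (leq_trans (dimvS (subvf _))) // dimvf.
  lia.
move=> x /memv_capP[xW]; rewrite memv_ker lfunE /= => /eqP phix0.
(* On the kernel of [phi] the total multiple of [b] is zero, so it can be subtracted freely; this
   writes [f x / z] as a combination of terms of order at least 1. *)
have fx : f x / z = \sum_(i < \dim W)
    iota (coord w i x) * (f (tnth w i) / z - iota (c i) * b).
  have -> : f x / z = f x / z - iota (phi x) * b by rewrite phix0 rmorph0 mul0r subr0.
  rewrite {1}(coord_vbasis xW) (klinear_sum _ _ f_lin) mulr_suml rmorph_sum mulr_suml.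
  rewrite -sumrB; apply: eq_bigr => i _.
  by rewrite (klinearZ _ _ f_lin) (tnth_nth 0) rmorphM; ring.
have fx_ge1 : val_ge P 1 (f x / z).
  rewrite fx; apply: val_ge_sum => i; rewrite -[1]add0r; apply: val_geM => //.
  exact: val_ge_scalar.
apply/RRE => Q; rewrite coeffB coeffU mul1r.
have [<-|_] := eqVneq P Q; last by rewrite subr0; move: Q; apply/RRE/WA.
rewrite -(divfK z0 (f x)) opprB; apply: val_geM => //.
by right; rewrite Pz.
Qed.

Lemma dim_drop_places (ps : seq (place iota)) A (W : {vspace V}) :
  (forall P, P \in ps -> rational P) ->
  (forall x, x \in W -> RR A (f x)) ->
  exists W' : {vspace V}, [/\ (W' <= W)%VS, (\dim W <= \dim W' + size ps)%N
    & forall x, x \in W' -> RR (A - \sum_(P <- ps) << P >>) (f x)].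
Proof.
elim: ps A W => [|P ps IHps] A W ps_rat WA.
  by exists W; rewrite addn0 big_nil subr0.
have [|W1 [sW1 dW1 W1A]] := dim_drop_place (P := P) _ WA.
  exact/ps_rat/mem_head.
have [|W2 [sW2 dW2 W2A]] := IHps _ _ _ W1A.
  by move=> Q Qps; apply: ps_rat; rewrite inE Qps orbT.
exists W2; split; first exact: subv_trans sW1.
  by rewrite /=; lia.
by move=> x xW2; rewrite big_cons opprD addrA; apply: W2A.
Qed.

Lemma dim_drop n (P : 'I_n -> place iota) m A (W : {vspace V}) :
  (forall i, rational (P i)) -> (forall x, x \in W -> RR A (f x)) ->
  exists W' : {vspace V}, [/\ (W' <= W)%VS, (\dim W <= \dim W' + n * m)%N
    & forall x, x \in W' -> RR (A - Ddiv P *+ m) (f x)].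
Proof.
move=> P_rat WA; elim: m => [|m [W1 [sW1 dW1 W1A]]].
  by exists W; rewrite muln0 addn0 mulr0n subr0.
have [|W2 [sW2 dW2 W2A]] := @dim_drop_places (codom P) _ _ _ W1A.
  by move=> _ /codomP[i ->].
exists W2; split; first exact: subv_trans sW1.
  by move: dW2; rewrite size_codom card_ord mulnS; lia.
move=> x /W2A; rewrite mulrSr opprD addrA /Ddiv.
by rewrite big_map enumT.
Qed.

End DimensionDrop.

(** Each cut is made inside the subspace left by the previous ones, so earlier conditions persist
    and the costs add up. *)
Lemma dim_drop_family (V : vectType K) n (P : 'I_n -> place iota)
    (f : nat -> V -> F) (A : nat -> divisor iota) (m : nat -> nat) T :
  (forall i, rational (P i)) -> (forall t, (t < T)%N -> klinear iota (f t)) ->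
  (forall t x, (t < T)%N -> RR (A t) (f t x)) ->
  exists W : {vspace V}, (\dim {:V} <= \dim W + n * \sum_(t < T) m t)%N /\
    forall t x, (t < T)%N -> x \in W -> RR (A t - Ddiv P *+ m t) (f t x).
Proof.
move=> P_rat f_lin fA; elim: T f_lin fA => [|T IHT] f_lin fA.
  by exists fullv; rewrite big_ord0 muln0 addn0.
have [t tT|t x tT|W [dW WA]] := IHT; [exact/f_lin/ltnW|exact/fA/ltnW|].
have [|x _|W' [sW' dW' W'A]] := @dim_drop _ (f T) _ _ P (m T) (A T) W P_rat.
- exact: f_lin.
- exact: fA.
exists W'; split.
  by rewrite big_ord_recr /= mulnDr addnCA addnC (leq_trans dW) ?leq_add2r.
move=> t x; rewrite ltnS leq_eqVlt => /orP[/eqP->|tT] xW'; first exact: W'A.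
by apply: WA => //; apply: (subvP sW').
Qed.

(** * Degrees of divisors *)

Lemma div_degD A B : div_deg (A + B) = div_deg A + div_deg B.
Proof.
(* The three supports can differ, so all degrees are computed over a common list; places outside a
   support contribute 0. *)
pose s := undup (dom A ++ dom B ++ dom (A + B)).
have degE C : {subset dom C <= s} ->
    div_deg C = \sum_(P <- s) coeff P C * (place_deg P)%:Z.
  move=> sC; rewrite /div_deg [RHS](bigID (mem (dom C))) /= [X in _ + X]big1 ?addr0.
    rewrite -[RHS]big_filter; apply: perm_big; apply: uniq_perm.
    - exact: uniq_dom.
    - by rewrite filter_uniq ?undup_uniq.
    by move=> P; rewrite mem_filter /=; case: (boolP (P \in dom C)) => // /sC.
  by move=> P /coeff_outdom->; rewrite mul0r.
rewrite !degE; try by move=> P PA; rewrite mem_undup !mem_cat PA ?orbT.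
by rewrite -big_split; apply: eq_bigr => P _ /=; rewrite coeffD mulrDl.
Qed.

Lemma div_degMn A m : div_deg (A *+ m) = div_deg A *+ m.
Proof.
elim: m => [|m IHm]; first by rewrite /div_deg !mulr0n dom0 big_nil.
by rewrite !mulrS div_degD IHm.
Qed.

Lemma div_deg_rational P k : rational P -> div_deg << k *g P >> = k.
Proof.
move=> P1; rewrite /div_deg; have [->|k0] := eqVneq k 0.
  by rewrite freegU0 dom0 big_nil.
by rewrite domU // big_seq1 coeffU eqxx P1 !mulr1.
Qed.

Lemma coeff_Ddiv_ge0 n (P : 'I_n -> place iota) Q : 0 <= coeff Q (Ddiv P).
Proof.
rewrite /Ddiv raddf_sum; apply: sumr_ge0 => i _ /=.
by rewrite coeffU mul1r ler0n.
Qed.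

End Valuations.

(** * Coordinates in the chosen bases *)

Section Coordinates.
Variables (K F : fieldType) (iota : {rmorphism K -> F}).
Variable beta : basis_choice iota.
Hypothesis betaP : is_basis_choice beta.
Implicit Types A B : divisor iota.

Lemma RR_beta A i : RR A (tnth (beta A) i).
Proof. exact: (betaP.1 A).1. Qed.

Lemma lincomb_inj A : injective (lincomb iota (beta A)).
Proof.
move=> c d cd; have [|e [_ eP]] := (betaP.1 A).2 (lincomb iota (beta A) c).
  by apply: RR_lincomb => i; apply: RR_beta.
by rewrite -(eP c) // (eP d).
Qed.

Lemma lincomb_coordv A h : RR A h -> lincomb iota (beta A) (coordv beta A h) = h.
Proof.
move=> /((betaP.1 A).2 h)[c [cP _]].
by apply: (@xgetPex _ 0 [set c | lincomb iota (beta A) c = h]%classic); exists c.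
Qed.

Lemma lincomb_klinear A : klinear iota (lincomb iota (beta A)).
Proof. exact: (@klinear_lincomb _ _ _ _ _ _ id). Qed.

(** Column j of the matrix holds the coordinates of [p] times the j-th basis element, which the
    hypothesis puts in L(B), where [coordv] does not fall back on its default; linearity does the
    rest. *)
Lemma lincomb_mulmat p A B x : (forall i, RR B (p * tnth (beta A) i)) ->
  lincomb iota (beta B) (mulmat beta p B A *m x) = p * lincomb iota (beta A) x.
Proof.
move=> pAB; rewrite {2}/lincomb mulr_sumr.
have -> : mulmat beta p B A *m x =
    \sum_j x j 0 *: coordv beta B (p * tnth (beta A) j).
  apply/colP => i; rewrite mxE summxE; apply: eq_bigr => j _.
  by rewrite !mxE mulrC.
rewrite (klinear_sum _ _ (lincomb_klinear (A:=B))); apply: eq_bigr => j _.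
rewrite (klinearZ _ _ (lincomb_klinear (A:=B))) lincomb_coordv //.
by rewrite mulrCA.
Qed.

End Coordinates.

(** * The system as key equations between functions *)

Section KeyEquations.
Variables (K F : fieldType) (iota : {rmorphism K -> F}).
Variables (n s l lam rho : nat).
Variables (P : 'I_n -> place iota) (Pinf : place iota) (G : divisor iota).
Variables (R : F) (beta : basis_choice iota).
Hypothesis betaP : is_basis_choice beta.
Hypothesis RP : RR (G + << rho%:Z *g Pinf >>) R.

Local Notation Vd := (Vdiv lam Pinf G).
Local Notation Qd := (Qdiv lam rho Pinf G).
Local Notation Wd := (Wdiv lam rho P Pinf G).

(** Translates membership in L(W_j) into the vanishing to order j along D that the dimension count
    delivers. *)
Lemma Wdiv_Qdiv j : Wd j = Qd j - Ddiv P *+ j.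
Proof. by rewrite /Wdiv mulrnBl addrA. Qed.

Lemma RR_Vdiv_Qdiv t f : RR (Vd t) f -> RR (Qd t) f.
Proof.
have -> : Vd t = Qd t - << rho%:Z *g Pinf >> *+ t.
  by rewrite /Vdiv /Qdiv mulrnDl addrA addrK.
apply: RR_sub => Q; rewrite coeffMn coeffU.
by rewrite mulrn_wge0 // mulr_ge0 // ler0n.
Qed.

(** Q_t - Q_j is t - j times G + rho Pinf, and [R] lies in L(G + rho Pinf). *)
Lemma RR_Qdiv_mulX j t f : (j <= t)%N -> RR (Qd j) f -> RR (Qd t) (R ^+ (t - j) * f).
Proof.
move=> jt Qf; have -> : Qd t = (G + << rho%:Z *g Pinf >>) *+ (t - j) + Qd j.
  by rewrite /Qdiv addrCA -mulrnDr subnK.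
by apply: RRM => //; apply: RRX.
Qed.

Lemma RR_Wdiv_Qdiv j f : RR (Wd j) f -> RR (Qd j) f.
Proof.
rewrite Wdiv_Qdiv; apply: RR_sub => Q; rewrite coeffMn.
by rewrite mulrn_wge0 // coeff_Ddiv_ge0.
Qed.

(** The candidate solution. The V-blocks start at index 1 and the W-blocks at 0, so [f 0] does not
    occur. *)
Definition key_vector (f e : nat -> F) : 'cV[K]_(nu s l lam rho P Pinf G) :=
  col_mx (\mxcol_(r < l) coordv beta (Vd r.+1) (f r.+1))
         (\mxcol_(j < s) coordv beta (Wd j) (e j)).

Lemma lincomb_Ublock f e t : (0 < t <= l)%N ->
  (forall r, (0 < r <= l)%N -> RR (Vd r) (f r)) ->
  (forall j, (j < s)%N -> RR (Wd j) (e j)) ->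
  lincomb iota (beta (Qd t))
    (Ublock s l lam rho P Pinf G R beta t *m key_vector f e) =
  f t - \sum_(j < s | (j <= t)%N) 'C(t, j)%:R * R ^+ (t - j) * e j.
Proof.
move=> tl fV eW; rewrite /Ublock /key_vector mul_row_col !mul_mxrow_mxcol.
have L := lincomb_klinear beta (A := Qd t).
rewrite -[X in X + _]scale1r L rmorph1 mul1r !(klinear_sum _ _ L) -sumrN.
congr (_ + _); last first.
  rewrite [RHS]big_mkcond /=; apply: eq_bigr => j _; rewrite /Wblock.
  case: leqP => jt; last first.
    by rewrite lincomb_mulmat ?mul0r // => i; rewrite mul0r; apply: RR0.
  rewrite mulNmx -scalemxAl -scaleNr (klinearZ _ _ L) rmorphN rmorph_nat.
  rewrite lincomb_mulmat //; last first.
    by move=> i; apply/RR_Qdiv_mulX/RR_Wdiv_Qdiv/RR_beta.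
  by rewrite lincomb_coordv ?mulrA ?mulNr //; apply: eW.
case: t tl L => // t /= tl L; rewrite (bigD1 (Ordinal tl)) //= big1 ?addr0.
  rewrite /Vblock eqxx lincomb_mulmat ?mul1r ?lincomb_coordv //; first exact: fV.
  by move=> i; rewrite mul1r; apply/RR_Vdiv_Qdiv/RR_beta.
move=> r rt; rewrite /Vblock eqSS ifN; last by rewrite eq_sym.
by rewrite lincomb_mulmat ?mul0r // => i; rewrite mul0r; apply: RR0.
Qed.

(** Confines the case analysis on the dependent height of [Kmat]. *)
Lemma mul_Kmat (k : 'I_l -> nat) (N : forall t : 'I_l, 'M[K]_(k t, ell (Qd t.+1)))
    (t : 'I_l) (y : 'cV[K]_(ell (Qd t.+1))) :
  (if (t.+1 < s)%N then y = 0 else N t *m y = 0) -> Kmat s beta N t *m y = 0.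
Proof.
rewrite /Kmat /Kheight; case: (t.+1 < s)%N => // ->; exact: mulmx0.
Qed.

(** For t < s the sum in row t contains the term j = t, which is e_t itself, so the row vanishes
    outright. For t >= s it leaves e_t, which the left kernel annihilates. *)
Lemma Umat_key_vector (k : 'I_l -> nat)
    (N : forall t : 'I_l, 'M[K]_(k t, ell (Qd t.+1))) f e :
  left_kernels s P beta N ->
  (forall r, (0 < r <= l)%N -> RR (Vd r) (f r)) ->
  (forall t, (t <= l)%N -> RR (Qd t - Ddiv P *+ minn t s) (e t)) ->
  (forall t, (t <= l)%N -> f t =
    e t + \sum_(j < minn t s) 'C(t, j)%:R * R ^+ (t - j) * e j) ->
  (s <= l)%N ->
  Umat s P R beta N *m key_vector f e = 0.
Proof.
move=> NP fV eQ fe sl; rewrite /Umat mxcol_mul -[RHS]mxcol0.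
apply: eq_mxcol => t; rewrite -mulmxA; apply: mul_Kmat.
have eW j : (j < s)%N -> RR (Wd j) (e j).
  move=> js; have := eQ j; rewrite (minn_idPl (ltnW js)) -Wdiv_Qdiv; apply.
  exact: leq_trans (ltnW js) sl.
have := @lincomb_Ublock f e t.+1 (ltn_ord t) fV eW.
rewrite fe ?ltn_ord //; case: ltnP => ts.
  (* The filter [j <= t.+1] is [j < t.+2] by computation, so the sum becomes one over ['I_t.+2],
     with last term [e t.+1]. *)
  rewrite -(@big_ord_widen _ _ _ _ _
    (fun j => 'C(t.+1, j)%:R * R ^+ (t.+1 - j) * e j) ts).
  rewrite [X in _ - X]big_ord_recr /= binn subnn !mul1r.
  rewrite [X in X - _]addrC subrr => U0.
  apply: (lincomb_inj betaP); rewrite U0.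
  by rewrite (klinear0 (lincomb_klinear beta (A := _))).
rewrite [X in _ - X](eq_bigl xpredT); last first.
  by move=> j; apply/ltnW/(leq_trans (ltn_ord j)).
rewrite addrK => Ue.
have eQs : RR (Qd t.+1 - Ddiv P *+ s) (e t.+1).
  by have := eQ _ (ltn_ord t); rewrite (minn_idPr ts).
(* The remainder lies in the smaller space, so its coordinates factor through the inclusion matrix
   whose left kernel is [N t]. *)
have -> : Ublock s l lam rho P Pinf G R beta t.+1 *m key_vector f e =
    mulmat beta 1 (Qd t.+1) (Qd t.+1 - Ddiv P *+ s) *m coordv beta _ (e t.+1).
  apply: (lincomb_inj betaP); rewrite Ue lincomb_mulmat ?mul1r ?lincomb_coordv //.
  move=> i; rewrite mul1r; apply: (@RR_sub _ _ _ _ (Ddiv P *+ s)); last exact: RR_beta.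
  by move=> Q; rewrite coeffMn mulrn_wge0 // coeff_Ddiv_ge0.
rewrite mulmxA; have [_ NM] := NP t ts.
suff -> : N t *m mulmat beta 1 (Qd t.+1) (Qd t.+1 - Ddiv P *+ s) = 0 by rewrite mul0mx.
by apply/row_matrixP => i; rewrite row_mul row0; apply/NM/row_sub.
Qed.

End KeyEquations.

(** * The recursion defining the e_t *)

Lemma recursive_family (F : fieldType) (V : Type) (f : nat -> V -> F) (R : F) s T :
  exists e : nat -> V -> F, forall t, (t < T)%N ->
    e t = fun x => f t x - \sum_(j < minn t s) 'C(t, j)%:R * R ^+ (t - j) * e j x.
Proof.
elim: T => [|T [e eP]]; first by exists f.
(* Changing the value at [T] preserves the earlier equations: the sum for t only involves indices
   below [minn t s], hence below t. *)
exists (fun t x => if t == T then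
  f t x - \sum_(j < minn t s) 'C(t, j)%:R * R ^+ (t - j) * e j x else e t x).
move=> t; rewrite ltnS => tT; apply/funext => x /=.
have -> : \sum_(j < minn t s) 'C(t, j)%:R * R ^+ (t - j) * (if j == T :> nat then
     f j x - \sum_(i < minn j s) 'C(j, i)%:R * R ^+ (j - i) * e i x else e j x)
   = \sum_(j < minn t s) 'C(t, j)%:R * R ^+ (t - j) * e j x.
  apply: eq_bigr => j _; rewrite ifN //.
  by have := ltn_ord j; rewrite leq_min => /andP[jt _]; apply/negP => /eqP; lia.
case: eqP => [->//|/eqP tT']; rewrite eP //; lia.
Qed.

(** * Counting conditions against dimensions *)

Lemma double_sum_minn s l : (s <= l)%N ->
  (2 * \sum_(t < l.+1) minn t s = s * (2 * l - s + 1))%N.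
Proof.
(* The terms equal t up to s, giving s(s + 1) after doubling; each of the remaining l - s terms
   equals s. *)
have sum_le m : (m <= s -> 2 * \sum_(t < m.+1) minn t s = m * m.+1)%N.
  elim: m => [|m IHm] ms; first by rewrite big_ord_recr big_ord0 /= min0n.
  by rewrite big_ord_recr /= mulnDr IHm ?(ltnW ms) // (minn_idPl ms); lia.
move=> /subnK <-; elim: (l - s)%N => [|d IHd].
  by rewrite add0n sum_le //; lia.
rewrite addSn big_ord_recr /= mulnDr IHd (minn_idPr _) //; nia.
Qed.

(** Multiplied by l + 1, the bound on lambda says that the Riemann estimate of the total dimension
    exceeds the number of conditions by more than 2l + 1, hence by at least 2. *)
Lemma lambda_bound (s l n lam g : nat) (gamma : int) : (s <= l)%N -> (0 < l)%N ->
  (s%:R * ((2 * l%:R - s%:R + 1) / (2 * (l%:R + 1))) * n%:R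
     - l%:R / 2 * gamma%:~R + l%:R / (l%:R + 1) + g%:R : rat) < lam%:R ->
  2 + (n * \sum_(t < l.+1) minn t s)%N%:Z
    <= \sum_(t < l.+1) (lam%:Z + gamma *+ t + 1 - g%:Z).
Proof.
(* Doubling clears the halves in both closed forms. *)
move=> sl l0 lamP; rewrite -(ler_pM2l (x := 2)) //.
have sumE m : 2 * (\sum_(t < m.+1) (lam%:Z + gamma *+ t + 1 - g%:Z)) =
    2 * m.+1%:Z * (lam%:Z + 1 - g%:Z) + gamma * (m%:Z * m.+1%:Z).
  elim: m => [|m IHm]; first by rewrite big_ord_recr big_ord0 /=; ring.
  rewrite big_ord_recr /= mulrDr IHm -mulr_natr natz !(intS _); ring.
rewrite sumE mulrDr -[2 * (n * _)%N%:Z]PoszM mulnCA double_sum_minn //.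
have l1 : 0 < (l%:R + 1 : rat) by rewrite ltr_wpDl // ler0n.
have lr0 : (1 : rat) <= l%:R by rewrite ler1n.
have slr : (s%:R : rat) <= l%:R by rewrite ler_nat.
rewrite -(ler_int rat).
have -> : (2 * 2 + Posz (n * (s * (2 * l - s + 1))))%:~R =
   4 + n%:R * (s%:R * (2 * l%:R - s%:R + 1)) :> rat.
  rewrite rmorphD /= -pmulrn !natrM natrD natrB ?natrM //; lia.
rewrite !(rmorphD, rmorphB, rmorphM) /= !intS !rmorphD /= -!pmulrn.
move: lamP; rewrite -(ltr_pM2r l1).
set L := (l%:R : rat) in l1 lr0 slr *; set S := (s%:R : rat) in slr *.
set X := (n%:R : rat); set c := (gamma%:~R : rat); set g' := (g%:R : rat).
set m := (lam%:R : rat).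
have -> : (S * ((2 * L - S + 1) / (2 * (L + 1))) * X - L / 2 * c + L / (L + 1) + g')
   * (L + 1) = S * (2 * L - S + 1) * X / 2 - L * (L + 1) * c / 2 + L + g' * (L + 1).
  by field; rewrite gt_eqF.
nra.
Qed.

(** * Pairs of independent vectors *)

Lemma two_dim_decoding_fails (K : fieldType) m n (M : 'M[K]_(m, n)) (u1 u2 : 'cV[K]_n) :
  M *m u1 = 0 -> M *m u2 = 0 -> free [:: u1; u2] -> decoding_fails M.
Proof.
move=> Mu1 Mu2 free_u; have : (<<[:: u1; u2]>> <= right_kernel M)%VS.
  apply/span_subvP => u; rewrite !inE memv_ker lfunE /=.
  by case/orP => /eqP->; apply/eqP.
by move=> /dimvS; rewrite (eqP free_u) => dimM dim1; rewrite dim1 in dimM.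
Qed.

Lemma free2P (K : fieldType) (V : vectType K) (u1 u2 : V) :
  reflect (forall a1 a2, a1 *: u1 + a2 *: u2 = 0 -> a1 = 0 /\ a2 = 0)
    (free [:: u1; u2]).
Proof.
apply: (iffP (@freeP _ _ _ [tuple u1; u2])) => [u_free a1 a2 a0|u_free k].
  have := u_free (fun i => [:: a1; a2]`_i).
  rewrite !big_ord_recl big_ord0 /= addr0 => /(_ a0) k0.
  by split; [apply: (k0 ord0)|apply: (k0 (lift ord0 ord0))].
rewrite !big_ord_recl big_ord0 /= addr0 => /u_free[k0 k1] i.
case: i => -[|[|//]] ilt; first by rewrite -k0; congr k; apply: val_inj.
by rewrite -k1; congr k; apply: val_inj.
Qed.

Lemma dim_gt1_free2 (K : fieldType) (V : vectType K) (W : {vspace V}) :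
  (1 < \dim W)%N -> exists u1 u2, [/\ u1 \in W, u2 \in W & free [:: u1; u2]].
Proof.
move=> W2; pose w := vbasis W.
exists w`_0, w`_1; split; try by apply: vbasis_mem; rewrite mem_nth // size_tuple; lia.
have wfree : free w := basis_free (vbasisP W).
have sw : (1 < size w)%N by rewrite size_tuple.
move: wfree sw; case: (tval w) => [|a [|b r]] //= wfree _.
by move: wfree; rewrite -[a :: _]/([:: a; b] ++ r); apply: catl_free.
Qed.

(** * Construction of two independent solutions *)

Theorem lemmaV4 (K F : fieldType) (iota : {rmorphism K -> F})
    (hF : function_field iota) (g : nat) (hg : has_genus iota g)
    (n : nat) (P : 'I_n -> place iota) (Pinf : place iota)
    (hPinj : injective P) (hPPinf : forall i, P i <> Pinf)
    (hPrat : forall i, rational (P i)) (hPinfrat : rational Pinf)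
    (G : divisor iota) (gamma : int) (hgamma : div_deg G = gamma)
    (hGD : forall Q : place iota, Q \in dom G -> Q \notin dom (Ddiv P))
    (s l lam : nat) (hs : (1 <= s)%N) (hsl : (s <= l)%N)
    (r : 'rV[K]_n) (rho : nat) (R : F)
    (hR : interpolator P Pinf G r rho R)
    (beta : basis_choice iota) (hbeta : is_basis_choice beta)
    (k : 'I_l -> nat)
    (N : forall t : 'I_l, 'M[K]_(k t, ell (Qdiv lam rho Pinf G t.+1)))
    (hN : left_kernels s P beta N)
    (hgammag : 2 * g%:Z - 2 <= gamma)
    (hlam : (s%:R * ((2 * l%:R - s%:R + 1) / (2 * (l%:R + 1))) * n%:R
              - l%:R / 2 * gamma%:~R + l%:R / (l%:R + 1) + g%:R : rat)
            < lam%:R) :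
  (exists u1 u2 : 'cV[K]_(nu s l lam rho P Pinf G),
     [/\ Umat s P R beta N *m u1 = 0, Umat s P R beta N *m u2 = 0
       & free [:: u1; u2]]) /\
  decoding_fails (Umat s P R beta N).
Proof.
suff: exists u1 u2 : 'cV[K]_(nu s l lam rho P Pinf G),
    [/\ Umat s P R beta N *m u1 = 0, Umat s P R beta N *m u2 = 0
      & free [:: u1; u2]].
  by move=> U; split=> //; case: U => u1 [u2 []]; apply: two_dim_decoding_fails.
have [RP _ _] := hR.
(* One column collects the coordinates of f_0, ..., f_l, including f_0. The index of [f] is a
   natural number read through [inord], faithful only for t <= l. *)
pose V := 'cV[K]_(\sum_(t < l.+1) ell (Vdiv lam Pinf G t)).
pose f t (c : V) :=
  lincomb iota (beta (Vdiv lam Pinf G (inord t : 'I_l.+1))) (submxcol c (inord t)).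
have f_lin t : klinear iota (f t).
  by apply: klinear_lincomb => a x y; apply/matrixP => i j; rewrite !mxE.
have fV t c : (t <= l)%N -> RR (Vdiv lam Pinf G t) (f t c).
  move=> tl; rewrite -{1}(@inordK l t) //.
  by apply: RR_lincomb => i; apply: RR_beta.
have f_inj c : (forall t, (t <= l)%N -> f t c = 0) -> c = 0.
  move=> fc0; rewrite -(submxcolK c) -[RHS]mxcol0; apply: eq_mxcol => t.
  have := fc0 t (ltn_ord t); rewrite /f inord_val => ft0.
  apply: (lincomb_inj hbeta); rewrite ft0.
  by rewrite (klinear0 (lincomb_klinear beta (A := _))).
have [e eE] := recursive_family f R s l.+1.
have e_lin t : (t < l.+1)%N -> klinear iota (e t).
  elim/ltn_ind: t => t IHt tl; rewrite eE //; apply: klinearB => //.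
  move=> a x y; rewrite mulr_sumr -big_split; apply: eq_bigr => j _ /=.
  have jt : (j < t)%N by have := ltn_ord j; rewrite leq_min => /andP[].
  by rewrite IHt //; [ring|apply: ltn_trans tl].
have eQ t c : (t < l.+1)%N -> RR (Qdiv lam rho Pinf G t) (e t c).
  elim/ltn_ind: t => t IHt tl; rewrite eE //; apply: RRB.
    exact/RR_Vdiv_Qdiv/fV.
  apply: RR_sum => j _; rewrite -mulrA; apply/RR_natmul.
  have jt : (j < t)%N by have := ltn_ord j; rewrite leq_min => /andP[].
  by apply: RR_Qdiv_mulX; [|apply: ltnW|apply: IHt => //; apply: ltn_trans tl].
have [W [dW We]] := dim_drop_family (fun t => minn t s) hPrat e_lin eQ.
have /dim_gt1_free2[c1 [c2 [Wc1 Wc2 c_free]]] : (1 < \dim W)%N.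
  have: 2 + (n * \sum_(t < l.+1) minn t s)%N%:Z <= (\dim {:V})%:Z.
    apply: (le_trans (lambda_bound hsl (leq_trans hs hsl) hlam)).
    have -> : (\dim {:V} = \sum_(t < l.+1) ell (Vdiv lam Pinf G t))%N.
      by rewrite dimvf; apply: muln1.
    rewrite -[leRHS]natz natr_sum; apply: ler_sum => t _.
    (* The first half of [has_genus] is Riemann's inequality. *)
    have := hg.1 (Vdiv lam Pinf G t).
    rewrite /Vdiv div_degD div_degMn div_deg_rational // hgamma natz.
    lia.
  move=> dV; have dW2 := leq_trans (dV : (2 + _ <= _)%N) dW.
  by rewrite leq_add2r in dW2.
pose u c := key_vector s l lam rho P Pinf G beta (f^~ c) (e^~ c).
have uU c : c \in W -> Umat s P R beta N *m u c = 0.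
  move=> Wc; apply: Umat_key_vector => //.
  - by move=> t /andP[_]; apply: fV.
  - by move=> t tl; apply: We.
  - by move=> t tl; rewrite [in RHS]eE // subrK.
exists (u c1), (u c2); split; [exact: uU|exact: uU|].
apply/free2P => a1 a2 u0; apply: (free2P _ _ c_free).
(* A relation between [u c1] and [u c2] passes to every [K]-linear function of the solution vector;
   this replaces linearity of [u]. *)
have kill (phi : 'cV[K]_(nu s l lam rho P Pinf G) -> F) :
    klinear iota phi -> iota a1 * phi (u c1) + iota a2 * phi (u c2) = 0.
  by move=> phiL; rewrite -(klinearZ a2 _ phiL) -phiL u0 (klinear0 phiL).
(* Since [c1] and [c2] are independent and the f_t are jointly injective, it remains to recover each
   f_t from the solution vector. *)
apply: f_inj => t tl; rewrite f_lin (klinearZ _ _ (f_lin t)).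
case: t tl => [_|t tl].
  (* f_0 has no V-block, but it equals e_0, which is stored in the W_0 block; that block exists
     because s >= 1. *)
  have e0 c : f 0%N c = e 0%N c by rewrite eE // min0n big_ord0 subr0.
  rewrite !e0.
  have Wu c : c \in W -> lincomb iota (beta (Wdiv lam rho P Pinf G (Ordinal hs)))
      (submxcol (dsubmx (u c)) (Ordinal hs)) = e 0%N c.
    move=> Wc; rewrite /u /key_vector col_mxKd mxcolK lincomb_coordv //.
    by have := We 0%N c isT Wc; rewrite Wdiv_Qdiv min0n.
  rewrite -(Wu _ Wc1) -(Wu _ Wc2).
  apply: (kill (fun x => lincomb iota _ (submxcol (dsubmx x) (Ordinal hs)))).
  by apply: klinear_lincomb => a x y; apply/matrixP => i j; rewrite !mxE.
have Vu c : lincomb iota (beta (Vdiv lam Pinf G (Ordinal tl).+1))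
    (submxcol (usubmx (u c)) (Ordinal tl)) = f t.+1 c.
  by rewrite /u /key_vector col_mxKu mxcolK lincomb_coordv //; apply: fV.
rewrite -!Vu.
apply: (kill (fun x => lincomb iota _ (submxcol (usubmx x) (Ordinal tl)))).
by apply: klinear_lincomb => a x y; apply/matrixP => i j; rewrite !mxE.
Qed.
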